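(* Let $S\subseteq\{0,1\}^n$ be a cube-ideal set-system with connectivity at least $2$. Then the $2$-cover graph $G(S)$ is a comparability graph (of a preorder on $[n]$).
   Context: A set-system is a subset $S\subseteq\{0,1\}^n$ with convex hull $\mathrm{conv}(S)$. A GSC inequality is $\sum_{i\in I}x_i+\sum_{j\in J}(1-x_j)\geq1$ for disjoint $I,J\subseteq[n]$, using $|I|+|J|$ variables; capacity inequalities are $x_i\geq0$, $x_i\leq1$. $S$ is cube-ideal if $\mathrm{conv}(S)$ is the solution set of a finite family of capacity and GSC inequalities. The connectivity of $S$ is the minimum number of variables in a GSC inequality valid for $\mathrm{conv}(S)$ ($+\infty$ if $S=\{0,1\}^n$). The $2$-cover graph $G(S)$ is the graph on $[n]$ with an edge $\{i,j\}$ for each pair of distinct indices such that at least one of $x_i+(1-x_j)\geq1$, $(1-x_i)+x_j\geq1$, $x_i+x_j\geq1$, $(1-x_i)+(1-x_j)\geq1$ is valid for $\mathrm{conv}(S)$. A preorder on $[n]$ is a reflexive transitive binary relation; its comparability graph has vertex set $[n]$ and an edge between every two distinct comparable elements. *)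

(* Defs.v *)
From mathcomp Require Import all_boot all_order all_algebra.
From mathcomp Require Import boolp classical_sets constructive_ereal reals.

Set Implicit Arguments.
Unset Strict Implicit.
Unset Printing Implicit Defensive.

Import Order.TTheory GRing.Theory Num.Theory.

Local Open Scope ring_scope.

Notation cube n := {ffun 'I_n -> bool}.

Definition vertex (R : realType) (n : nat) (s : cube n) : 'rV[R]_n :=
  \row_i (s i)%:R.

Arguments vertex R {n} s.

Definition conv_hull (R : realType) (n : nat) (S : {set cube n}) : set 'rV[R]_n :=
  [set x | exists w : cube n -> R,
     [/\ forall s, s \in S -> 0 <= w s,
         \sum_(s in S) w s = 1
       & x = \sum_(s in S) w s *: vertex R s]]%classic.

Arguments conv_hull R {n} S _.

Definition valid (R : realType) (n : nat) (S : {set cube n})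
    (ineq : pred 'rV[R]_n) : Prop :=
  forall x, conv_hull R S x -> ineq x.

(* The pair (I, J) stands for the inequality
   sum_(i in I) x_i + sum_(j in J) (1 - x_j) >= 1.
   Both sets may be empty, giving the infeasible inequality 0 >= 1, so the
   empty set-system is cube-ideal and has connectivity 0. *)
Notation gsc n := {p : {set 'I_n} * {set 'I_n} | [disjoint p.1 & p.2]}.

Definition gsc_holds (R : realType) (n : nat) (g : gsc n) : pred 'rV[R]_n :=
  fun x => 1 <= \sum_(i in (val g).1) x ord0 i
                + \sum_(j in (val g).2) (1 - x ord0 j).

Definition gsc_nvars (n : nat) (g : gsc n) : nat :=
  (#|(val g).1| + #|(val g).2|)%N.

Inductive cube_ineq (n : nat) : Type :=
  | CapacityLower of 'I_n
  | CapacityUpper of 'I_n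
  | Gsc of gsc n.

Definition cube_ineq_holds (R : realType) (n : nat) (c : cube_ineq n) :
    pred 'rV[R]_n :=
  fun x => match c with
           | CapacityLower i => 0 <= x ord0 i
           | CapacityUpper i => x ord0 i <= 1
           | Gsc g => gsc_holds g x
           end.

Definition cube_ideal (R : realType) (n : nat) (S : {set cube n}) : Prop :=
  exists cs : seq (cube_ineq n),
    conv_hull R S = [set x | all (fun c => cube_ineq_holds c x) cs]%classic.

(* The minimum over no inequality is +oo; this happens exactly when S is the
   whole cube, since a missing vertex v is cut off by the GSC inequality with
   I = {i | v_i = 0} and J = {j | v_j = 1}. *)
Definition connectivity (R : realType) (n : nat) (S : {set cube n}) : \bar R :=
  \big[Order.min/+oo%E]_(g : gsc n | `[< valid S (gsc_holds (R := R) g) >])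
     ((gsc_nvars g)%:R)%:E.

Definition cover2_graph (R : realType) (n : nat) (S : {set cube n}) :
    rel 'I_n :=
  fun i j => (i != j) &&
    `[< [\/ valid S (fun x : 'rV[R]_n => 1 <= x ord0 i + (1 - x ord0 j)),
            valid S (fun x : 'rV[R]_n => 1 <= (1 - x ord0 i) + x ord0 j),
            valid S (fun x : 'rV[R]_n => 1 <= x ord0 i + x ord0 j)
          | valid S (fun x : 'rV[R]_n =>
              1 <= (1 - x ord0 i) + (1 - x ord0 j))] >].

Definition preorder (T : Type) (r : rel T) : Prop :=
  reflexive r /\ transitive r.

Definition comparability_graph (T : eqType) (r : rel T) : rel T :=
  fun x y => (x != y) && (r x y || r y x).

(* Main.v *)
(** The point [h = (1/2, ..., 1/2)] satisfies the capacity inequalities and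
    every GSC inequality on at least two variables, so connectivity at least 2
    and cube-idealness put it in [conv(S)].  Let [s] be a point of [S] of
    positive weight in a convex combination giving [h].  Valid GSC inequalities
    on two variables are tight at [h], hence at [s]: exactly one of the two
    literals is true at [s].  After complementing the coordinates [i] with
    [s i = 1], each of them therefore reads [x_j >= x_i], and these
    inequalities form a preorder on the indices. *)

Require Import Defs.
From mathcomp Require Import all_boot all_order all_algebra.
From mathcomp Require Import boolp classical_sets constructive_ereal reals.
From mathcomp Require Import lra.

Set Implicit Arguments.
Unset Strict Implicit.
Unset Printing Implicit Defensive.

Import Order.TTheory GRing.Theory Num.Theory.

Local Open Scope ring_scope.

Definition literal (R : realType) (b : bool) (t : R) : R :=
  if b then t else 1 - t.

Definition clause2 (R : realType) (n : nat) (a b : bool) (i j : 'I_n) :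
    pred 'rV[R]_n :=
  fun x => 1 <= literal a (x ord0 i) + literal b (x ord0 j).

Arguments clause2 R {n} a b i j.

Definition half_point (R : realType) (n : nat) : 'rV[R]_n := const_mx (2^-1).

Section CubeIdeal.
Variables (R : realType) (n : nat).
Implicit Types (S : {set cube n}) (s : cube n) (i j : 'I_n) (g : gsc n).

(** A literal is affine in the point; total weight 1 absorbs the constant of a negated literal. *)
Lemma literal_sum S (w : cube n -> R) b i :
  \sum_(s in S) w s = 1 ->
  literal b ((\sum_(s in S) w s *: vertex R s) ord0 i)
    = \sum_(s in S) w s * literal b (s i)%:R.
Proof.
move=> w1; rewrite summxE /literal; case: b.
  by apply: eq_bigr => s _; rewrite !mxE.
rewrite -{1}w1 -sumrB; apply: eq_bigr => s _.
by rewrite !mxE mulrBr mulr1.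
Qed.

Lemma vertex_conv_hull S s : s \in S -> conv_hull R S (vertex R s).
Proof.
move=> sS; exists (fun t => (t == s)%:R); split=> [t _||].
- exact: ler0n.
- rewrite (bigD1 s) //= eqxx big1 ?addr0 // => t /andP[_ /negbTE->] //.
- rewrite (bigD1 s) //= eqxx scale1r big1 ?addr0 // => t /andP[_ /negbTE->].
  by rewrite scale0r.
Qed.

(** Every literal equals 1/2 there, so the left-hand side is half the number of variables. *)
Lemma gsc_holds_half_point g :
  (2 <= gsc_nvars g)%N -> gsc_holds g (half_point R n).
Proof.
rewrite /gsc_nvars /gsc_holds => g2.
under eq_bigr do rewrite mxE.
under [X in _ + X]eq_bigr do rewrite mxE.
rewrite !sumr_const.
have -> : 1 - 2^-1 = 2^-1 :> R by lra.
rewrite -mulrnDr -mulr_natr.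
have : (2%:R : R) <= (#|(val g).1| + #|(val g).2|)%:R by rewrite ler_nat.
by lra.
Qed.

Lemma connectivity_le S g :
  valid S (gsc_holds (R := R) g) ->
  (connectivity R S <= ((gsc_nvars g)%:R)%:E)%E.
Proof. by move=> gS; apply: bigmin_le_cond; apply/asboolP. Qed.

Lemma half_point_conv_hull S :
  cube_ideal R S -> (2%:E <= connectivity R S)%E ->
  conv_hull R S (half_point R n).
Proof.
move=> [cs csE] conn2.
(* Each inequality of the description is valid for [S], so the connectivity bounds its number of
   variables from below. *)
have inS c (x : 'rV[R]_n) :
    List.In c cs -> conv_hull R S x -> cube_ineq_holds c x.
  rewrite csE /=; elim: cs {csE} => //= d cs IH [->|cin] /andP[] //.
  by move=> _; exact: IH.
have holds c : List.In c cs -> cube_ineq_holds c (half_point R n).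
  case: c => [i|i|g] cin; rewrite /cube_ineq_holds ?mxE.
  - by rewrite invr_ge0 ler0n.
  - by rewrite invf_le1 ?ler1n ?ltr0n.
  apply: gsc_holds_half_point.
  have gS : valid S (gsc_holds (R := R) g) by move=> x; exact: (inS (Gsc g)).
  have := le_trans conn2 (connectivity_le gS).
  by rewrite lee_fin ler_nat.
rewrite csE /=; elim: cs holds {csE inS} => //= c cs IH holds.
rewrite holds /=; last by left.
by apply: IH => d din; apply: holds; right.
Qed.

(** Complementary slackness: [s] is chosen by its weight alone, before any clause, so it serves all
    of them at once. *)
Lemma clause2_tight_point S :
  conv_hull R S (half_point R n) ->
  exists2 s, s \in S & forall a b i j, valid S (clause2 R a b i j) ->
    literal a (s i)%:R + literal b (s j)%:R = 1 :> R.
Proof.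
move=> [w [w0 w1 hE]].
have [s sS ws] : exists2 s, s \in S & w s != 0.
  apply/exists_inP; apply: contraPT w1 => /exists_inPn w0'.
  rewrite big1 => [|s sS]; first by apply/eqP; rewrite eq_sym oner_eq0.
  by have := w0' s sS; rewrite negbK => /eqP.
exists s => // a b i j clS.
pose f (t : cube n) : R := literal a (t i)%:R + literal b (t j)%:R.
have f1 t : t \in S -> 1 <= f t.
  by move=> tS; have := clS _ (vertex_conv_hull tS); rewrite /clause2 !mxE.
have litE c : literal c (2^-1) = 2^-1 :> R by rewrite /literal; case: c; lra.
(* The weighted mean of the slacks is the slack at the half point, 1/2 + 1/2 - 1. As no term is
   negative, each one vanishes. *)
have sum0 : \sum_(t in S) w t * (f t - 1) = 0.
  have litS c k : \sum_(t in S) w t * literal c (t k)%:R = 2^-1.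
    by rewrite -literal_sum // -hE mxE litE.
  under eq_bigr do rewrite mulrBr mulr1 mulrDr.
  by rewrite sumrB big_split /= !litS w1; lra.
have /(_ s sS)/eqP : forall t, t \in S -> w t * (f t - 1) = 0.
  apply/psumr_eq0P => // t tS.
  by rewrite mulr_ge0 ?w0 // subr_ge0 f1.
by rewrite mulf_eq0 (negbTE ws) subr_eq0 => /eqP.
Qed.

Lemma cover2_graphP S i j :
  reflect (i != j /\ exists a b, valid S (clause2 R a b i j))
          (cover2_graph R S i j).
Proof.
apply: (iffP andP) => -[ij H]; split=> //.
  case/asboolP: H => H;
    [exists true, false|exists false, true|exists true, true|exists false, false];
    exact: H.
apply/asboolP; case: H => -[] [[] H].
- by constructor 3.
- by constructor 1.
- by constructor 2.
- by constructor 4.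
Qed.

End CubeIdeal.

Theorem theorem4p2 (R : realType) (n : nat) (S : {set cube n})
    (ideal_S : cube_ideal R S) (conn_S : (2%:E <= connectivity R S)%E) :
  exists r : rel 'I_n, preorder r /\ cover2_graph R S =2 comparability_graph r.
Proof.
have {ideal_S conn_S} [s sS tight] :=
  clause2_tight_point (half_point_conv_hull ideal_S conn_S).
(* These coordinates place [s] at the origin. *)
pose y i (x : 'rV[R]_n) : R := literal (~~ s i) (x ord0 i).
exists (fun i j => `[< valid S (fun x => y i x <= y j x) >]); split.
  split=> [i|j i k /asboolP ij /asboolP jk]; apply/asboolP => x xS //.
  exact: le_trans (ij x xS) (jk x xS).
move=> i j; apply/cover2_graphP/andP => -[ij H]; split=> //.
  case: H => a [b H]; have := tight _ _ _ _ H.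
  rewrite /literal => sE; apply/orP.
  (* The literal of sign [a] is true at [s] iff [a = s i]. A true literal is [1 - y] and a false one
     is [y], so the two cases give [y i <= y j] and [y j <= y i]. *)
  have [sab|sab] : (a = s i /\ b = ~~ s j) \/ (a = ~~ s i /\ b = s j).
  - by move: sE; case: a {H}; case: b; case: (s i); case: (s j) => /= sE;
      (by left) || (by right) || (exfalso; lra).
  - left; apply/asboolP => x xS; have := H x xS; case: sab => -> ->.
    by rewrite /clause2 /y /literal; case: (s i); case: (s j) => /=; lra.
  - right; apply/asboolP => x xS; have := H x xS; case: sab => -> ->.
    by rewrite /clause2 /y /literal; case: (s i); case: (s j) => /=; lra.
(* Conversely, [y i <= y j] rewrites as the clause [1 <= (1 - y i) + y j]. *)
case/orP: H => /asboolP H; [exists (s i), (~~ s j)|exists (~~ s i), (s j)];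
  move=> x xS; have := H x xS;
  by rewrite /clause2 /y /literal; case: (s i); case: (s j) => /=; lra.
Qed.
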